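(* Let a group $G$ act on a probability space $(X,\mu)$ by measurable transformations such that $\mu$ is quasi-invariant, and suppose that the action is ergodic and measure contracting. Then the associated Koopman representation $\kappa$ of $G$ on $L^2(X,\mu)$ is irreducible.
   Context: Let $G$ act on a probability space $(X,\mu)$ by measurable transformations with $\mu$ quasi-invariant (the action preserves the measure class of $\mu$). For $g\in G$, $\frac{d\mu(g(x))}{d\mu(x)}$ denotes the Radon-Nikodym derivative with respect to $\mu$ of the measure $B\mapsto\mu(gB)$, and $\operatorname{supp}(g)=\{x\in X: gx\neq x\}$. The action is called measure contracting if for every measurable subset $A\subset X$ and any $M,\epsilon>0$ there exists $g\in G$ such that 1) $\mu(\operatorname{supp}(g)\setminus A)<\epsilon$; 2) $\mu\left(\left\{x\in A:\sqrt{\tfrac{d\mu(g(x))}{d\mu(x)}}<M^{-1}\right\}\right)>\mu(A)-\epsilon$. The action is ergodic if every measurable $A\subset X$ with $\mu(gA\,\triangle\,A)=0$ for all $g\in G$ satisfies $\mu(A)\in\{0,1\}$. The Koopman representation $\kappa$ of $G$ is the unitary representation in the complex Hilbert space $L^2(X,\mu)$ given by $$(\kappa(g)f)(x)=\sqrt{\frac{d\mu(g^{-1}(x))}{d\mu(x)}}\,f(g^{-1}x).$$ Irreducible means that the only closed $\kappa(G)$-invariant subspaces are $\{0\}$ and the whole space. *)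

(* Defs.v *)
From HB Require Import structures.
From mathcomp Require Import all_boot all_order all_algebra.
From mathcomp Require Import ring_quotient complex.
From mathcomp Require Import all_classical all_reals all_analysis measurable_realfun.

Set Implicit Arguments.
Unset Strict Implicit.
Unset Printing Implicit Defensive.

Import Order.TTheory GRing.Theory Num.Theory.
Import numFieldNormedType.Exports.
Import ComplexField.Normc.

Local Open Scope classical_set_scope.
Local Open Scope complex_scope.
Local Open Scope charge_scope.
Local Open Scope ring_scope.

Local Notation Re := (@complex.Re _).
Local Notation Im := (@complex.Im _).

Section cmod.
Context {R : realType}.
Implicit Types z w : R[i].

Definition cmod z : R := normc z.
Arguments cmod : simpl never.

Lemma cmodE z : cmod z = Num.sqrt (Re z ^+ 2 + Im z ^+ 2).
Proof. by case: z. Qed.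

Lemma cmod0 : cmod 0 = 0. Proof. exact: normc0. Qed.

Lemma cmod_ge0 z : 0 <= cmod z. Proof. by rewrite cmodE sqrtr_ge0. Qed.

Lemma cmodM z w : cmod (z * w) = cmod z * cmod w. Proof. exact: normcM. Qed.

Lemma le_cmodD z w : cmod (z + w) <= cmod z + cmod w.
Proof. exact: le_normcD. Qed.

Lemma cmod_eq0 z : cmod z = 0 -> z = 0. Proof. exact: eq0_normc. Qed.

Lemma cmod_real (a : R) : cmod a%:C = `|a|.
Proof. by rewrite cmodE /= expr0n addr0 sqrtr_sqr. Qed.

End cmod.

Section L2.
Context d (X : measurableType d) (R : realType).
Variable mu : {measure set X -> \bar R}.
Implicit Types f g : X -> R[i].

(* R[i] carries no sigma-algebra in the library; this is Borel measurability
   under the identification of R[i] with R * R. *)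
Definition cmeasurable f :=
  measurable_fun setT (Re \o f) /\ measurable_fun setT (Im \o f).

Definition sq_integrable : {pred X -> R[i]} :=
  [pred f | `[< cmeasurable f /\ finite_norm mu 2%:E (cmod \o f) >]].

Lemma sq_integrableP f :
  f \in sq_integrable <-> cmeasurable f /\ finite_norm mu 2%:E (cmod \o f).
Proof. by split=> [/asboolP|H]; [|apply/asboolP]. Qed.

Lemma measurable_sqrt : measurable_fun setT (Num.sqrt : R -> R).
Proof. apply: continuous_measurable_fun; exact: sqrt_continuous. Qed.

Lemma measurable_cmod f : cmeasurable f -> measurable_fun setT (cmod \o f).
Proof.
move=> [mr mi].
have -> : cmod \o f = Num.sqrt \o (fun x => (Re \o f) x ^+ 2 + (Im \o f) x ^+ 2).
  by apply/funext => x /=; rewrite cmodE.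
apply: (measurableT_comp measurable_sqrt).
by apply: measurable_funD; apply: measurable_funX.
Qed.

Lemma cmeasurable0 : cmeasurable (fun=> 0).
Proof. by split; exact: measurable_cst. Qed.

Lemma cmeasurableD f g : cmeasurable f -> cmeasurable g -> cmeasurable (f + g).
Proof.
move=> [fr fi] [gr gi]; split.
- rewrite (_ : _ \o _ = (Re \o f) \+ (Re \o g)); first exact: measurable_funD.
  by apply/funext => x /=; rewrite fctE; case: (f x) (g x) => [? ?] [].
- rewrite (_ : _ \o _ = (Im \o f) \+ (Im \o g)); first exact: measurable_funD.
  by apply/funext => x /=; rewrite fctE; case: (f x) (g x) => [? ?] [].
Qed.

Lemma cmeasurableZ a f : cmeasurable f -> cmeasurable (a *: f).
Proof.
case: a => a b [fr fi]; split.
- rewrite (_ : _ \o _ = (fun x => a * (Re \o f) x - b * (Im \o f) x)); last first.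
    by apply/funext => x /=; rewrite fctE; case: (f x).
  by apply: measurable_funB; apply: measurable_funM.
- rewrite (_ : _ \o _ = (fun x => a * (Im \o f) x + b * (Re \o f) x)); last first.
    by apply/funext => x /=; rewrite fctE; case: (f x).
  by apply: measurable_funD; apply: measurable_funM.
Qed.

Local Notation N f := (Lnorm mu 2%:E (EFin \o (cmod \o f))).

Lemma le_N (u v : X -> R) : measurable_fun setT u -> measurable_fun setT v ->
  (forall x, `|u x| <= `|v x|) ->
  (Lnorm mu 2%:E (EFin \o u) <= Lnorm mu 2%:E (EFin \o v))%E.
Proof.
move=> mu_ mv uv; rewrite unlock; apply: gt0_ler_poweR => //.
- by rewrite in_itv/= leey integral_ge0// => x _; exact: poweR_ge0.
- by rewrite in_itv/= leey integral_ge0// => x _; exact: poweR_ge0.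
apply: ge0_le_integral => //=.
- apply/measurable_EFinP; apply: (measurableT_comp (measurable_powR _)).
  exact: measurableT_comp.
- apply/measurable_EFinP; apply: (measurableT_comp (measurable_powR _)).
  exact: measurableT_comp.
- by move=> x _; rewrite lee_fin ge0_ler_powR// nnegrE.
Qed.

Lemma N_triangle f g : cmeasurable f -> cmeasurable g ->
  (N (f + g)%R <= N f + N g)%E.
Proof.
move=> mf mg; apply: le_trans; last first.
  by apply: minkowski_EFin; rewrite ?ler1n//; exact: measurable_cmod.
apply: le_N => [||x].
- exact/measurable_cmod/cmeasurableD.
- by apply: measurable_funD; exact: measurable_cmod.
- by rewrite /= !ger0_norm ?addr_ge0 ?cmod_ge0//; exact: le_cmodD.
Qed.

Lemma N_scale a f : cmeasurable f -> (N (a *: f)%R = (cmod a)%:E * N f)%E.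
Proof.
move=> mf; rewrite unlock /=.
under eq_integral => x _.
  rewrite /= cmodM normrM powRM// EFinM; over.
have m2 : measurable_fun setT (fun x => (`|cmod (f x)| `^ 2)%:E).
  apply/measurable_EFinP; apply: (measurableT_comp (measurable_powR _)).
  by apply: measurableT_comp => //; exact: measurable_cmod.
rewrite ge0_integralZl//.
rewrite poweRM; [|by rewrite lee_fin powR_ge0
  |by apply: integral_ge0 => x _; rewrite lee_fin powR_ge0].
congr (_ * _)%E; rewrite poweR_EFin -powRrM divff// powRr1//.
by rewrite ger0_norm ?cmod_ge0.
Qed.

Lemma N0 : N (fun=> 0%R) = 0%E.
Proof.
rewrite (_ : _ \o _ = cst 0%E); first by rewrite Lnorm0// eqe.
by apply/funext => x; rewrite /comp cmod0.
Qed.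

Lemma sq_integrable_submod_closed : submod_closed sq_integrable.
Proof.
split=> [|a f g /sq_integrableP[mf Nf] /sq_integrableP[mg Ng]].
  apply/sq_integrableP; split; first exact: cmeasurable0.
  by rewrite /finite_norm N0.
have maf := cmeasurableZ a mf.
apply/sq_integrableP; split; first exact: cmeasurableD.
rewrite /finite_norm; apply: (le_lt_trans (N_triangle maf mg)).
rewrite lte_add_pinfty// N_scale//.
by rewrite lte_mul_pinfty// lee_fin cmod_ge0.
Qed.

HB.instance Definition _ := GRing.isSubmodClosed.Build _ _ sq_integrable
  sq_integrable_submod_closed.

Record L2fun := MkL2fun { l2f :> X -> R[i]; l2fP : l2f \in sq_integrable }.

HB.instance Definition _ := [isSub for l2f].
HB.instance Definition _ := [Choice of L2fun by <:].
HB.instance Definition _ := [SubChoice_isSubLmodule of L2fun by <:].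

Definition ae_null : {pred L2fun} :=
  [pred f : L2fun | `[< {ae mu, forall x, f x = 0} >]].

Lemma ae_null_zmod_closed : zmod_closed ae_null.
Proof.
split=> [|f g]; rewrite !inE.
  exact: filterE.
move=> f0 g0; apply: filterS2 f0 g0 => x /= fx gx.
by rewrite !fctE fx gx subr0.
Qed.

HB.instance Definition _ := GRing.isZmodClosed.Build _ ae_null
  ae_null_zmod_closed.

(* Square-integrable functions modulo almost-everywhere equality; the instance
   of [normedModType R[i]] below gives it the topology of the L^2 norm. *)
Definition L2 : Type := Quotient.quot ae_null.

HB.instance Definition _ := GRing.Zmodule.on L2.
HB.instance Definition _ := EqQuotient.on L2.

Local Open Scope quotient_scope.

Lemma L2_eqP (f g : L2fun) :
  \pi_L2 f = \pi_L2 g <-> {ae mu, forall x, f x = g x}.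
Proof.
split=> [/eqP|fg].
  rewrite -Quotient.idealrBE inE; apply: filterS => x /=.
  by rewrite !fctE => /eqP; rewrite subr_eq0 => /eqP.
apply/eqP; rewrite -Quotient.idealrBE inE.
by apply: filterS fg => x /= fgx; rewrite !fctE fgx subrr.
Qed.

Lemma L2_reprE (f : L2fun) : {ae mu, forall x, repr (\pi_L2 f) x = f x}.
Proof. by apply/L2_eqP; rewrite reprK. Qed.

Lemma L2_piD (f g : L2fun) : \pi_L2 (f + g) = \pi_L2 f + \pi_L2 g.
Proof. exact: Quotient.pi_add. Qed.

Lemma L2_pi0 : \pi_L2 (0 : L2fun) = 0.
Proof. by apply: (addrI (\pi_L2 0)); rewrite -L2_piD !addr0. Qed.

Definition L2scale (a : R[i]) (u : L2) : L2 := \pi_L2 (a *: repr u).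

Lemma L2scale_pi a (f : L2fun) : L2scale a (\pi_L2 f) = \pi_L2 (a *: f).
Proof.
rewrite /L2scale; apply/L2_eqP; apply: filterS (L2_reprE f) => x /= fx.
by rewrite !fctE fx.
Qed.

Lemma L2scaleA a b u : L2scale a (L2scale b u) = L2scale (a * b) u.
Proof. by rewrite -[u]reprK (L2scale_pi b) !L2scale_pi scalerA. Qed.

Lemma L2scale1 : left_id 1 L2scale.
Proof. by move=> u; rewrite -[u]reprK !L2scale_pi scale1r. Qed.

Lemma L2scaleDr : right_distributive L2scale +%R.
Proof.
move=> a u v; rewrite -[u]reprK -[v]reprK -L2_piD !L2scale_pi.
by rewrite scalerDr L2_piD.
Qed.

Lemma L2scaleDl u : {morph L2scale^~ u : a b / a + b}.
Proof.
by move=> a b; rewrite -[u]reprK !L2scale_pi scalerDl L2_piD.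
Qed.

HB.instance Definition _ := GRing.Zmodule_isLmodule.Build R[i] L2
  L2scaleA L2scale1 L2scaleDr L2scaleDl.

Lemma ae_eq_N f g : cmeasurable f -> cmeasurable g ->
  {ae mu, forall x, f x = g x} -> N f = N g.
Proof.
move=> mf mg fg; rewrite unlock; congr (_ `^ _)%E.
apply: ae_eq_integral => //.
- apply/measurable_EFinP; apply: (measurableT_comp (measurable_powR _)).
  by apply: measurableT_comp => //; exact: measurable_cmod.
- apply/measurable_EFinP; apply: (measurableT_comp (measurable_powR _)).
  by apply: measurableT_comp => //; exact: measurable_cmod.
- by apply: filterS fg => x /= ->.
Qed.

Lemma cmeasurable_L2fun (f : L2fun) : cmeasurable f.
Proof. by have /sq_integrableP[] := l2fP f. Qed.

Lemma N_fin_num (f : L2fun) : N f \is a fin_num.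
Proof.
have /sq_integrableP[_ Nf] := l2fP f.
by rewrite ge0_fin_numE ?Lnorm_ge0.
Qed.

Definition L2norm (u : L2) : R[i] := (fine (N (repr u)))%:C.

Lemma L2norm_pi (f : L2fun) : L2norm (\pi_L2 f) = (fine (N f))%:C.
Proof.
congr ((fine _)%:C); apply: ae_eq_N; [exact: cmeasurable_L2fun..|].
exact: L2_reprE.
Qed.

Lemma L2normD u v : L2norm (u + v) <= L2norm u + L2norm v.
Proof.
rewrite -[u]reprK -[v]reprK -L2_piD !L2norm_pi -rmorphD/= lecR.
rewrite -fineD ?N_fin_num//; apply: fine_le.
- exact: (N_fin_num (repr u + repr v)).
- by rewrite fin_numD !N_fin_num.
- by apply: N_triangle; exact: cmeasurable_L2fun.
Qed.

Lemma L2normZ a u : L2norm (a *: u) = `|a| * L2norm u.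
Proof.
rewrite -[u]reprK [_ *: _]L2scale_pi !L2norm_pi N_scale; last first.
  exact: cmeasurable_L2fun.
by rewrite fineM ?N_fin_num// rmorphM/=; case: a.
Qed.

Lemma L2norm_eq0 u : L2norm u = 0 -> u = 0.
Proof.
rewrite -[u]reprK L2norm_pi => /complexI N0.
have : N (repr u) = 0%E by rewrite -(fineK (N_fin_num _)) N0.
move=> /Lnorm_eq0_eq0 => H; rewrite -[RHS]reprK; apply/L2_eqP.
have h0 := L2_reprE 0; rewrite L2_pi0 in h0.
have mu2 : measurable_fun setT (EFin \o (cmod \o repr u)).
  by apply/measurable_EFinP; exact/measurable_cmod/cmeasurable_L2fun.
have {}H : EFin \o (cmod \o repr u) = \0 %[ae mu].
  by apply: H => //; rewrite lte_fin.
apply: filterS2 h0 H => x /= -> /(_ I) [].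
exact: cmod_eq0.
Qed.

HB.instance Definition _ := Lmodule_isNormed.Build R[i] L2
  L2normD L2normZ L2norm_eq0.

End L2.

(* A bijective linear isometry of a Hilbert space preserves the inner product,
   and each [unitary_rep_map g] is bijective by the last two fields. *)
Record unitary_rep (G : groupType) (C : numFieldType) (V : normedModType C) :=
  UnitaryRep {
    unitary_rep_map :> G -> V -> V;
    unitary_rep_linear : forall g, linear (unitary_rep_map g);
    unitary_rep_isometry : forall g v, `|unitary_rep_map g v| = `|v|;
    unitary_rep1 : forall v, unitary_rep_map 1%g v = v;
    unitary_repM : forall g h v,
      unitary_rep_map (g * h)%g v = unitary_rep_map g (unitary_rep_map h v) }.

Definition irreducible (G : groupType) (C : numFieldType)
    (V : normedModType C) (pi : unitary_rep G V) :=
  forall W : set V, submod_closed (mem W) -> closed W ->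
    (forall g v, W v -> W (pi g v)) -> W = [set 0] \/ W = setT.

Section action.
Context d (X : measurableType d) (R : realType).
Variables (mu : probability X R) (G : groupType).

Record qi_action := QIAction {
  qi_act :> G -> X -> X;
  qi_act1 : forall x, qi_act 1%g x = x;
  qi_actM : forall g h x, qi_act (g * h)%g x = qi_act g (qi_act h x);
  qi_act_measurable : forall g, measurable_fun [set: X] (qi_act g);
  qi_act_quasi_invariant : forall g B, measurable B ->
    mu (qi_act g @` B) = 0%E <-> mu B = 0%E }.

Variable a : qi_action.

Lemma qi_actK g : cancel (a g) (a g^-1%g).
Proof. by move=> x; rewrite -qi_actM mulVg qi_act1. Qed.

Lemma qi_actVK g : cancel (a g^-1%g) (a g).
Proof. by move=> x; rewrite -qi_actM mulgV qi_act1. Qed.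

Lemma qi_act_image g B : a g @` B = a g^-1%g @^-1` B.
Proof.
apply/seteqP; split=> [_ [x Bx <-]|x Bx] /=; first by rewrite qi_actK.
by exists (a g^-1%g x); rewrite ?qi_actVK.
Qed.

Lemma measurable_qi_act_preimage g B : measurable B -> measurable (a g @^-1` B).
Proof.
by move=> mB; rewrite -[X in measurable X]setTI; exact: qi_act_measurable.
Qed.

Lemma measurable_qi_act_image g B : measurable B -> measurable (a g @` B).
Proof. by rewrite qi_act_image; exact: measurable_qi_act_preimage. Qed.

Definition translate g : set X -> \bar R := fun B => mu (a g @` B).

Section translate_measure.
Variable g : G.

Let translate0 : translate g set0 = 0%E.
Proof. by rewrite /translate image_set0 measure0. Qed.

Let translate_ge0 B : (0 <= translate g B)%E.
Proof. exact: measure_ge0. Qed.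

Let translate_sigma_additive : semi_sigma_additive (translate g).
Proof.
move=> F mF tF mUF; rewrite /translate image_bigcup.
apply: measure_semi_sigma_additive.
- by move=> n; exact: measurable_qi_act_image.
- apply/trivIsetP => i j _ _ ij; rewrite !qi_act_image -preimage_setI.
  by move/trivIsetP : tF => /(_ _ _ _ _ ij) ->//; rewrite preimage_set0.
- by rewrite -image_bigcup; exact: measurable_qi_act_image.
Qed.

HB.instance Definition _ := isMeasure.Build _ _ _ (translate g)
  translate0 translate_ge0 translate_sigma_additive.

Let translate_fin : fin_num_fun (translate g).
Proof. by move=> B mB; exact/fin_num_measure/measurable_qi_act_image. Qed.

HB.instance Definition _ := Measure_isFinite.Build _ _ _ (translate g)
  translate_fin.

End translate_measure.

Lemma translate_dominates g : translate g `<< mu.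
Proof.
apply/null_content_dominatesP => B mB mB0.
by apply/(qi_act_quasi_invariant a g mB).
Qed.

(* The derivative of [translate g] with respect to [mu]; the chosen version is
   finite everywhere, so [fine] loses nothing, and it is nonnegative only almost
   everywhere ([RN_ge0]). *)
Definition RN g : X -> R :=
  fine \o ('d (charge_of_finite_measure (translate g)) '/d mu).

Lemma measurable_RN g : measurable_fun setT (RN g).
Proof.
apply: measurableT_comp => //.
apply: measurable_int; apply: Radon_Nikodym_integrable.
exact: translate_dominates.
Qed.

Lemma RN_ge0 g : {ae mu, forall x, 0 <= RN g x}.
Proof.
have /= := ae_eq_Radon_Nikodym_SigmaFinite (translate_dominates g) measurableT.
apply: filterS => x /(_ I) H; rewrite /RN/= -H fine_ge0//.
by apply: Radon_Nikodym_SigmaFinite.f_ge0; exact: translate_dominates.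
Qed.

Lemma RN_integral g F : measurable_fun setT F -> (forall x, 0 <= F x)%E ->
  (\int[mu]_x (F x * (RN g x)%:E) = \int[mu]_x F (a g^-1%g x))%E.
Proof.
move=> mF F0.
have dom := translate_dominates g.
transitivity (\int[translate g]_x F x)%E.
  rewrite -(Radon_Nikodym_SigmaFinite.change_of_variables dom F0)//.
  apply: ae_eq_integral => //.
  - apply: emeasurable_funM => //.
    by apply/measurable_EFinP; exact: measurable_RN.
  - apply: emeasurable_funM => //.
    exact: measurable_int (Radon_Nikodym_SigmaFinite.f_integrable dom).
  - apply: ae_eqe_mul2l.
    have /= := ae_eq_Radon_Nikodym_SigmaFinite dom measurableT.
    apply: filterS => x /(_ I) H _; rewrite /RN /= -H fineK//.
    exact: Radon_Nikodym_SigmaFinite.f_fin_num.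
have mg := qi_act_measurable a g^-1%g.
have := @ge0_integral_pushforward _ _ _ _ _ (a g^-1%g) mg mu setT F measurableT mF
  (fun x _ => F0 x).
rewrite preimage_setT => <-.
apply: eq_measure_integral => B mB _.
by rewrite /= /translate qi_act_image.
Qed.


Lemma EFin_RN g x :
  (RN g x)%:E = ('d (charge_of_finite_measure (translate g)) '/d mu) x.
Proof.
rewrite /RN /comp fineK//; apply: Radon_Nikodym_fin_num.
exact: translate_dominates.
Qed.

Lemma RN_int g B : measurable B ->
  (\int[mu]_(x in B) (RN g x)%:E = translate g B)%E.
Proof.
move=> mB; have dom := translate_dominates g.
rewrite [RHS](Radon_Nikodym_integral
  (nu := charge_of_finite_measure (translate g)) dom mB); apply: eq_integral => x _.
exact: EFin_RN.
Qed.

Lemma RN_integrable g : mu.-integrable setT (EFin \o RN g).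
Proof.
have dom := translate_dominates g.
apply: eq_integrable (Radon_Nikodym_integrable
  (nu := charge_of_finite_measure (translate g)) dom) => // x _.
by rewrite /comp EFin_RN.
Qed.

Lemma RN_unique g (h : X -> R) : measurable_fun setT h ->
  (forall B, measurable B -> (\int[mu]_(x in B) (h x)%:E = translate g B)%E) ->
  {ae mu, forall x, RN g x = h x}.
Proof.
move=> mh hE.
have : ae_eq mu setT (EFin \o RN g) (EFin \o h).
  apply: integral_ae_eq => //; first exact: RN_integrable.
    exact/measurable_EFinP.
  by move=> B _ mB; rewrite RN_int// -hE.
by apply: filterS => x /= /(_ I) [].
Qed.

Lemma ae_qi_act g (P : set X) : {ae mu, forall x, P x} ->
  {ae mu, forall x, P (a g x)}.
Proof.
move=> [B [mB muB PB]]; exists (a g @^-1` B); split.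
- exact: measurable_qi_act_preimage.
- rewrite -[g]invgK -qi_act_image.
  by apply/(qi_act_quasi_invariant a g^-1%g mB).
- by move=> x /= Px; exact: PB.
Qed.

Lemma RN1 : {ae mu, forall x, RN 1%g x = 1}.
Proof.
apply: (RN_unique (h := cst 1)) => // B mB.
rewrite (eq_integral (cst 1%E))// integral_cst// mul1e /translate; congr (mu _).
by rewrite qi_act_image invg1; apply/seteqP; split => x /=; rewrite qi_act1.
Qed.

Lemma RNM g h : {ae mu, forall x, RN (g * h)%g x = RN h x * RN g (a h x)}.
Proof.
have mgh : measurable_fun setT (fun x => RN g (a h x)).
  by apply: (measurableT_comp (measurable_RN g)); exact: qi_act_measurable.
apply: RN_unique => [|B mB].
  by apply: measurable_funM => //; exact: measurable_RN.
pose F x := (\1_B x * `|RN g (a h x)|)%:E.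
have mF : measurable_fun setT F.
  apply/measurable_EFinP; apply: measurable_funM => //.
  exact: measurableT_comp.
have F0 x : (0 <= F x)%E by rewrite lee_fin mulr_ge0.
transitivity (\int[mu]_x (F x * (RN h x)%:E))%E.
  rewrite integral_mkcond; apply: ae_eq_integral => //.
  - apply/(measurable_restrictT _ mB); apply: measurable_funTS.
    by apply/measurable_EFinP; apply: measurable_funM => //; exact: measurable_RN.
  - by apply: emeasurable_funM => //; apply/measurable_EFinP; exact: measurable_RN.
  - apply: filterS (ae_qi_act h (RN_ge0 g)) => x /= gx0 _.
    rewrite /F ger0_norm// patchE indicE; case: (x \in B).
      by rewrite mul1r -EFinM mulrC.
    by rewrite mul0r mul0e.
rewrite RN_integral//.
have mhB : measurable (a h @` B) by exact: measurable_qi_act_image.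
transitivity (\int[mu]_(x in a h @` B) (RN g x)%:E)%E; last first.
  rewrite RN_int// /translate image_comp; congr (mu (_ @` _)).
  by apply/funext => x /=; rewrite qi_actM.
rewrite [RHS]integral_mkcond; apply: ae_eq_integral => //.
- by apply: (measurableT_comp mF); exact: qi_act_measurable.
- apply/(measurable_restrictT _ mhB); apply: measurable_funTS.
  by apply/measurable_EFinP; exact: measurable_RN.
- apply: filterS (RN_ge0 g) => x gx0 _.
  rewrite /F qi_actVK ger0_norm// patchE indicE qi_act_image.
  rewrite (_ : (x \in _) = (a h^-1%g x \in B)); last first.
    by apply/idP/idP; rewrite !inE.
  by case: (_ \in B); rewrite ?mul1r ?mul0r.
Qed.

Definition koopman_fun g (f : X -> R[i]) : X -> R[i] :=
  fun x => (Num.sqrt (RN g^-1%g x))%:C * f (a g^-1%g x).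

Lemma cmeasurable_koopman_fun g f : cmeasurable f ->
  cmeasurable (koopman_fun g f).
Proof.
move=> [fr fi].
have mg := qi_act_measurable a g^-1%g.
have ms : measurable_fun setT (fun x => Num.sqrt (RN g^-1%g x)).
  by apply: (measurableT_comp (@measurable_sqrt R)); exact: measurable_RN.
split.
- rewrite (_ : _ \o _ =
    (fun x => Num.sqrt (RN g^-1%g x) * (Re \o f) (a g^-1%g x))).
    by apply: measurable_funM => //; exact: measurableT_comp fr mg.
  by apply/funext => x; rewrite /koopman_fun /=; case: (f _) => p q /=;
    rewrite mul0r subr0.
- rewrite (_ : _ \o _ =
    (fun x => Num.sqrt (RN g^-1%g x) * (Im \o f) (a g^-1%g x))).
    by apply: measurable_funM => //; exact: measurableT_comp fi mg.
  by apply/funext => x; rewrite /koopman_fun /=; case: (f _) => p q /=;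
    rewrite mul0r addr0.
Qed.

Lemma Lnorm_koopman_fun g f : cmeasurable f ->
  Lnorm mu 2%:E (EFin \o (cmod \o koopman_fun g f)) =
  Lnorm mu 2%:E (EFin \o (cmod \o f)).
Proof.
move=> mf; rewrite unlock; congr (_ `^ _)%E.
have mP (h : X -> R[i]) : cmeasurable h ->
    measurable_fun setT (fun x => (`|cmod (h x)| `^ 2)%:E).
  move=> mh; apply/measurable_EFinP.
  apply: (measurableT_comp (measurable_powR _)).
  by apply: measurableT_comp => //; exact: measurable_cmod.
pose F x := (`|cmod (f (a g^-1%g x))| `^ 2)%:E.
have mF : measurable_fun setT F.
  by apply: (measurableT_comp (mP _ mf)); exact: qi_act_measurable.
transitivity (\int[mu]_x (F x * (RN g^-1%g x)%:E))%E.
  apply: ae_eq_integral => //.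
  - exact/mP/cmeasurable_koopman_fun.
  - by apply: emeasurable_funM => //; apply/measurable_EFinP; exact: measurable_RN.
  - apply: filterS (RN_ge0 g^-1%g) => x r0 _ /=.
    rewrite /F -EFinM /koopman_fun cmodM cmod_real normrM.
    rewrite !powR_mulrn// exprMn normr_id real_normK ?num_real// sqr_sqrtr//.
    by rewrite mulrC.
rewrite RN_integral// => [|x]; last by rewrite lee_fin powR_ge0.
by apply: eq_integral => x _; rewrite /F invgK qi_actK.
Qed.

Lemma koopman_fun_sq_integrable g (f : L2fun mu) :
  koopman_fun g f \in sq_integrable mu.
Proof.
have /sq_integrableP[mf Nf] := l2fP f.
apply/sq_integrableP; split; first exact: cmeasurable_koopman_fun.
by rewrite /finite_norm Lnorm_koopman_fun.
Qed.

Definition koopman_L2fun g (f : L2fun mu) : L2fun mu :=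
  MkL2fun (koopman_fun_sq_integrable g f).

Local Open Scope quotient_scope.

Definition koopman_map g (u : L2 mu) : L2 mu :=
  \pi_(L2 mu) (koopman_L2fun g (repr u)).

Lemma koopman_map_pi g f :
  koopman_map g (\pi_(L2 mu) f) = \pi_(L2 mu) (koopman_L2fun g f).
Proof.
rewrite /koopman_map; apply/L2_eqP.
apply: filterS (ae_qi_act g^-1%g (L2_reprE f)) => x /= fx.
by rewrite /koopman_fun fx.
Qed.

Lemma koopman_map_linear g : linear (koopman_map g).
Proof.
move=> c; elim/quotW=> f; elim/quotW=> h.
rewrite [c *: \pi_(L2 mu) f]L2scale_pi -L2_piD !koopman_map_pi.
rewrite [c *: \pi_(L2 mu) _]L2scale_pi -L2_piD; congr (\pi_(L2 mu) _).
apply/val_inj/funext => x /=; rewrite /koopman_fun /= !fctE /=.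
by rewrite mulrDr mulrCA.
Qed.

Lemma koopman_map_isometry g u : `|koopman_map g u| = `|u|.
Proof.
rewrite -[u]reprK koopman_map_pi.
rewrite [LHS]L2norm_pi [RHS]L2norm_pi Lnorm_koopman_fun//.
exact: cmeasurable_L2fun.
Qed.

Lemma koopman_map1 u : koopman_map 1%g u = u.
Proof.
rewrite -[u]reprK koopman_map_pi; apply/L2_eqP.
apply: filterS RN1 => x /= r1.
by rewrite /koopman_fun invg1 r1 sqrtr1 mul1r qi_act1.
Qed.

Lemma koopman_mapM g h u :
  koopman_map (g * h)%g u = koopman_map g (koopman_map h u).
Proof.
elim/quotW: u => f.
rewrite (koopman_map_pi (g * h)%g) (koopman_map_pi h) (koopman_map_pi g).
apply/L2_eqP.
apply: filterS2 (RN_ge0 g^-1%g) (RNM h^-1%g g^-1%g) => x /= r0 rM.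
rewrite /koopman_fun invgM rM sqrtrM// rmorphM/= mulrA.
by rewrite qi_actM.
Qed.

Definition koopman : unitary_rep G (L2 mu) :=
  UnitaryRep koopman_map_linear koopman_map_isometry koopman_map1 koopman_mapM.

Lemma koopmanE g (u : L2 mu) : {ae mu, forall x,
  repr (koopman g u) x = (Num.sqrt (RN g^-1%g x))%:C * repr u (a g^-1%g x)}.
Proof. exact: L2_reprE. Qed.

Definition supp g : set X := [set x | a g x <> x].

Definition ergodic := forall A, measurable A ->
  (forall g, mu ((a g @` A) `+` A) = 0%E) ->
  mu A = 0%E \/ mu A = 1%E.

(* [supp g] need not be measurable for an arbitrary sigma-algebra, hence the
   outer measure, which coincides with [mu] on measurable sets. *)
Definition measure_contracting := forall A, measurable A ->
  forall M e : R, 0 < M -> 0 < e -> exists g,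
    (mu_ext mu (supp g `\` A) < e%:E)%E /\
    (mu A - e%:E < mu [set x | A x /\ (Num.sqrt (RN g x) < M^-1)%R])%E.

End action.

(* Main.v *)
Require Import Defs.
From mathcomp Require Import all_boot all_order all_algebra.
From mathcomp Require Import all_classical all_reals all_analysis.
From mathcomp Require Import ring_quotient complex measurable_realfun ring lra.

(* Let W be a closed invariant subspace and f in W. If g contracts A and is close
   to the identity off A, then kappa(g^-1) f is weakly close to f 1_(~A), since
   on A it is f \o g times a small factor. Hence W is stable under
   multiplication by indicator functions. If h is almost orthogonal to W it is
   then almost orthogonal to every f 1_A, so |f h| has a small integral; this
   forces every function vanishing off {f <> 0} to lie in W. Among the sets B
   such that W contains all functions vanishing off B there is one of maximal
   measure; maximality makes it invariant modulo null sets, and ergodicity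
   concludes. *)

Set Implicit Arguments.
Unset Strict Implicit.
Unset Printing Implicit Defensive.

Import Order.TTheory GRing.Theory Num.Theory.
Import numFieldNormedType.Exports.

Local Open Scope classical_set_scope.
Local Open Scope complex_scope.
Local Open Scope ring_scope.

Local Notation Re := (@complex.Re _).
Local Notation Im := (@complex.Im _).

Lemma cmod1 (R : realType) : cmod (1 : R[i]) = 1.
Proof. by rewrite -(rmorph1 (real_complex R)) cmod_real normr1. Qed.

(** * Real inner product on the complex plane *)

Section dot.
Context {R : realType}.
Implicit Types z w : R[i].

(** The real part of the Hermitian product of [z] and [w]; its imaginary part is [dot ('i * z) w],
    so real integrals suffice throughout. *)
Definition dot z w : R := Re z * Re w + Im z * Im w.

Lemma dotC z w : dot z w = dot w z.
Proof. by rewrite /dot; ring. Qed.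

Lemma dotDr z w v : dot z (w + v) = dot z w + dot z v.
Proof. by case: z w v => [? ?] [? ?] [? ?]; rewrite /dot /=; ring. Qed.

Lemma dotZr (t : R) z w : dot z (t%:C * w) = t * dot z w.
Proof. by case: z w => [? ?] [? ?]; rewrite /dot /=; ring. Qed.

Lemma dotxx z : dot z z = cmod z ^+ 2.
Proof.
by rewrite cmodE sqr_sqrtr ?addr_ge0 ?sqr_ge0// /dot !expr2.
Qed.

Lemma cmod_sqr_dot z w :
  (cmod z * cmod w) ^+ 2 = dot z w ^+ 2 + dot ('i * z) w ^+ 2.
Proof.
rewrite exprMn -!dotxx; case: z w => [? ?] [? ?]; rewrite /dot /=; ring.
Qed.

Lemma le_dot z w : dot z w <= cmod z * cmod w.
Proof.
apply: (le_trans (ler_norm _)); rewrite -ler_sqr ?nnegrE ?mulr_ge0 ?cmod_ge0//.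
by rewrite cmod_sqr_dot real_normK ?num_real// lerDl sqr_ge0.
Qed.

Lemma cmodM_le_dot z w : cmod z * cmod w <= `|dot z w| + `|dot ('i * z) w|.
Proof.
rewrite -ler_sqr ?nnegrE ?addr_ge0 ?mulr_ge0 ?cmod_ge0//.
rewrite cmod_sqr_dot [leRHS]sqrrD !real_normK ?num_real// addrAC lerDl.
by rewrite mulrn_wge0 ?mulr_ge0.
Qed.

End dot.

(** * Real inner product of square-integrable functions *)

Section L2dot.
Context d (X : measurableType d) (R : realType).
Variable mu : {measure set X -> \bar R}.
Implicit Types f g h : L2fun mu.

Lemma measurable_dot (f g : X -> R[i]) : cmeasurable f -> cmeasurable g ->
  measurable_fun setT (fun x => dot (f x) (g x)).
Proof.
by move=> [fr fi] [gr gi]; apply: measurable_funD; apply: measurable_funM.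
Qed.

Lemma integrable_cmod2 f : mu.-integrable setT (fun x => (cmod (f x) ^+ 2)%:E).
Proof.
have /sq_integrableP[mf] := l2fP f.
have mf2 : measurable_fun setT (fun x => (cmod (f x) ^+ 2)%:E).
  apply/measurable_EFinP; apply: measurable_funX; exact: measurable_cmod.
rewrite /finite_norm unlock /= => N2; apply/integrableP; split => //.
rewrite (eq_integral (fun x => (`|cmod (f x)| `^ 2)%:E)); last first.
  move=> x _; rewrite powR_mulrn// real_normK ?num_real//.
  by rewrite gee0_abs// lee_fin sqr_ge0.
by apply: lty_poweRy N2; rewrite invr_eq0.
Qed.

Lemma integrable_dot f g : mu.-integrable setT (fun x => (dot (f x) (g x))%:E).
Proof.
have := integrableD measurableT (integrable_cmod2 f) (integrable_cmod2 g).
apply: le_integrable => //.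
  by apply/measurable_EFinP/measurable_dot; exact: cmeasurable_L2fun.
move=> x _ /=; rewrite lee_fin [leRHS]ger0_norm ?addr_ge0 ?sqr_ge0//.
rewrite -!dotxx /dot ler_norml.
set a := Re _; set b := Re _; set c := Im _; set e := Im _.
have := sqr_ge0 (a + b); have := sqr_ge0 (a - b).
have := sqr_ge0 (c + e); have := sqr_ge0 (c - e).
by rewrite !expr2 => *; apply/andP; split; nra.
Qed.

(** Taken on functions rather than classes, hence only positive semidefinite; [L2norm_dot] relates
    it to the norm of the quotient. *)
Definition L2dot f g : R := \int[mu]_x dot (f x) (g x).

Lemma L2dotC f g : L2dot f g = L2dot g f.
Proof. by apply: eq_Rintegral => x _; rewrite dotC. Qed.

Lemma L2dotDr f g h : L2dot f (g + h) = L2dot f g + L2dot f h.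
Proof.
rewrite -RintegralD//; [|exact: integrable_dot..].
by apply: eq_Rintegral => x _; rewrite -dotDr.
Qed.

Lemma L2dotZr (t : R) f g : L2dot f (t%:C *: g) = t * L2dot f g.
Proof.
rewrite -RintegralZl//; last exact: integrable_dot.
by apply: eq_Rintegral => x _; rewrite -dotZr.
Qed.

Lemma L2dotDl f g h : L2dot (f + g) h = L2dot f h + L2dot g h.
Proof. by rewrite !(L2dotC _ h) L2dotDr. Qed.

Lemma L2dotZl (t : R) f g : L2dot (t%:C *: f) g = t * L2dot f g.
Proof. by rewrite !(L2dotC _ g) L2dotZr. Qed.

Lemma L2dotNr f g : L2dot f (- g) = - L2dot f g.
Proof. by rewrite -scaleN1r -(rmorphN1 (real_complex R)) L2dotZr mulN1r. Qed.

Lemma L2dotNl f g : L2dot (- f) g = - L2dot f g.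
Proof. by rewrite L2dotC L2dotNr L2dotC. Qed.

Lemma L2dotxx_ge0 f : 0 <= L2dot f f.
Proof. by apply: Rintegral_ge0 => x _; rewrite dotxx sqr_ge0. Qed.

Lemma L2norm_dot f : L2norm (\pi_(L2 mu)%qT f) = (Num.sqrt (L2dot f f))%:C.
Proof.
rewrite L2norm_pi; congr (_%:C).
rewrite unlock /L2dot /Rintegral /=.
rewrite (@eq_integral _ _ _ _ _ (fun x => (dot (f x) (f x))%:E)); last first.
  by move=> x _; rewrite powR_mulrn// real_normK ?num_real// dotxx.
rewrite -[X in (X `^ _)%E]fineK; last first.
  exact: (integrable_fin_num measurableT (integrable_dot f f)).
by rewrite poweR_EFin/= powR12_sqrt//; exact: L2dotxx_ge0.
Qed.

Lemma ae_eq_Rintegral (u v : X -> R) : measurable_fun setT u ->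
  measurable_fun setT v -> {ae mu, forall x, u x = v x} ->
  \int[mu]_x u x = \int[mu]_x v x.
Proof.
move=> mu_ mv uv; rewrite /Rintegral; congr fine; apply: ae_eq_integral => //.
- exact/measurable_EFinP.
- exact/measurable_EFinP.
- by apply: filterS uv => x /= ->.
Qed.

Lemma ae_le_Rintegral (u v : X -> R) : mu.-integrable setT (EFin \o u) ->
  mu.-integrable setT (EFin \o v) -> {ae mu, forall x, u x <= v x} ->
  \int[mu]_x u x <= \int[mu]_x v x.
Proof.
move=> iu iv uv.
have iw : mu.-integrable setT (EFin \o (v \- u)) by exact: (integrableB measurableT iv iu).
have /measurable_EFinP mw := measurable_int _ iw.
(* [Rintegral_ge0] asks for pointwise nonnegativity, so [v - u] is replaced by its absolute value,
   equal to it almost everywhere. *)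
rewrite -subr_ge0 -RintegralB// (@ae_eq_Rintegral _ (Num.norm \o (v \- u)))//.
- by apply: Rintegral_ge0 => x _ /=.
- exact: measurableT_comp.
- by apply: filterS uv => x /= uvx; rewrite ger0_norm// subr_ge0.
Qed.

End L2dot.

(** * Multiplication by indicator functions *)

Section restriction.
Context d (X : measurableType d) (R : realType).
Variable mu : {measure set X -> \bar R}.
Implicit Types f g h : L2fun mu.

Lemma le_sq_integrable f (g : X -> R[i]) : cmeasurable g ->
  (forall x, cmod (g x) <= cmod (f x)) -> g \in sq_integrable mu.
Proof.
move=> mg gf; have /sq_integrableP[mf Nf] := l2fP f.
apply/sq_integrableP; split => //; apply: le_lt_trans Nf.
apply: le_N => [||x]; [exact: measurable_cmod..|].
by rewrite !ger0_norm ?cmod_ge0// gf.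
Qed.

Definition restr_fun (A : set X) (f : X -> R[i]) : X -> R[i] :=
  fun x => if x \in A then f x else 0.

Lemma cmeasurable_restr_fun A (f : X -> R[i]) : measurable A ->
  cmeasurable f -> cmeasurable (restr_fun A f).
Proof.
move=> mA [mr mi]; split.
- rewrite (_ : _ \o _ = (fun x => \1_A x * (Re \o f) x)).
    by apply: measurable_funM.
  by apply/funext => x; rewrite indicE /restr_fun /=; case: ifP => _;
    rewrite ?mul1r ?mul0r.
- rewrite (_ : _ \o _ = (fun x => \1_A x * (Im \o f) x)).
    by apply: measurable_funM.
  by apply/funext => x; rewrite indicE /restr_fun /=; case: ifP => _;
    rewrite ?mul1r ?mul0r.
Qed.

Lemma restr_sq_integrable A (mA : measurable A) f :
  restr_fun A f \in sq_integrable mu.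
Proof.
apply: (@le_sq_integrable f).
  exact/cmeasurable_restr_fun/cmeasurable_L2fun.
by move=> x; rewrite /restr_fun; case: ifP => // _; rewrite cmod0 cmod_ge0.
Qed.

Definition L2restr A (mA : measurable A) f : L2fun mu :=
  MkL2fun (restr_sq_integrable mA f).

Lemma L2restrE A (mA : measurable A) f x :
  L2restr mA f x = if x \in A then f x else 0.
Proof. by []. Qed.

(** Dominated convergence with majorant [|f|^2]: every point eventually leaves the sets [C n]. *)
Lemma L2dot_restr_small (C : nat -> set X) (mC : forall n, measurable (C n)) f e :
  (forall x, \forall n \near \oo, ~ C n x) -> 0 < e ->
  exists n, L2dot (L2restr (mC n) f) (L2restr (mC n) f) < e.
Proof.
move=> C0 e0.
pose F n x := (dot (L2restr (mC n) f x) (L2restr (mC n) f x))%:E.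
have [] := @dominated_convergence _ _ _ mu _ measurableT F (cst 0%E)
  (fun x => (dot (f x) (f x))%:E).
- by move=> n; exact: (measurable_int _ (integrable_dot _ _)).
- exact: measurable_cst.
- apply: aeW => x _; apply: cvg_near_cst; apply: filterS (C0 x) => n Cnx.
  by rewrite /F L2restrE memNset// dotxx cmod0 expr0n.
- exact: integrable_dot.
- apply: aeW => x n _; rewrite /F L2restrE !dotxx gee0_abs ?lee_fin ?sqr_ge0//.
  by case: ifP => // _; rewrite cmod0 expr0n sqr_ge0.
move=> _ _; rewrite integral0.
have -> : (fun n => \int[mu]_x F n x)%E =
    EFin \o (fun n => L2dot (L2restr (mC n) f) (L2restr (mC n) f)).
  apply/funext => n /=; rewrite /L2dot /Rintegral fineK//.
  exact: (integrable_fin_num measurableT (integrable_dot _ _)).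
move=> /fine_cvgP[_] /cvgrPdist_lt/(_ _ e0)[N _ /(_ N (leqnn N))] /=.
by rewrite sub0r normrN ger0_norm ?L2dotxx_ge0//; exists N.
Qed.

End restriction.

(** * Closed subspaces and separation of a point from them *)

Section closed_subspace.
Context d (X : measurableType d) (R : realType).
Variable mu : {measure set X -> \bar R}.
Implicit Types (f g h u v w p : L2fun mu) (V : set (L2fun mu)).

Lemma L2dotBB (t : R) f g : L2dot (f - t%:C *: g) (f - t%:C *: g) =
  L2dot f f - 2 * t * L2dot f g + t ^+ 2 * L2dot g g.
Proof.
rewrite L2dotDr L2dotNr L2dotZr !L2dotDl !L2dotNl !L2dotZl (L2dotC g f).
by ring.
Qed.

(** A closed linear subspace described on functions instead of classes. Closedness also makes it
    stable under changes on null sets, which lie at distance 0 ([L2subspace_ae]). *)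
Definition L2subspace V :=
  [/\ V 0, forall c f g, V f -> V g -> V (c *: f + g) &
      forall f, (forall e, 0 < e -> exists2 g, V g & L2dot (f - g) (f - g) < e) ->
        V f].

Lemma ae_eq_L2dot f g h : {ae mu, forall x, f x = g x} -> L2dot h f = L2dot h g.
Proof.
move=> fg; apply: ae_eq_Rintegral.
- by apply: measurable_dot; exact: cmeasurable_L2fun.
- by apply: measurable_dot; exact: cmeasurable_L2fun.
- by apply: filterS fg => x /= ->.
Qed.

Section theory.
Variable V : set (L2fun mu).
Hypothesis VS : L2subspace V.

Lemma L2subspaceZ c f : V f -> V (c *: f).
Proof. by case: VS => V0 VD _ Vf; rewrite -[_ *: _]addr0; exact: VD. Qed.

Lemma L2subspaceD f g : V f -> V g -> V (f + g).
Proof. by case: VS => _ VD _ Vf Vg; rewrite -[f]scale1r; exact: VD. Qed.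

Lemma L2subspaceB f g : V f -> V g -> V (f - g).
Proof.
by move=> Vf Vg; rewrite -scaleN1r; apply: L2subspaceD => //; exact: L2subspaceZ.
Qed.

Lemma L2subspace_ae f g : {ae mu, forall x, f x = g x} -> V f -> V g.
Proof.
case: VS => _ _ Vcl fg Vf; apply: Vcl => e e0; exists f => //.
rewrite (@ae_eq_L2dot _ 0); last first.
  by apply: filterS fg => x /= fgx; rewrite !fctE fgx subrr.
by rewrite -(scale0r 0) -(rmorph0 (real_complex R)) L2dotZr mul0r.
Qed.

(* The vector h is p - w for w in V nearly minimizing the distance to p, so that
   neither orthogonal projections nor completeness of L^2 are needed. *)
Lemma L2subspace_separation p : ~ V p -> exists2 c, 0 < c & forall e, 0 < e ->
  exists2 h, (forall u, V u -> L2dot h u <= e * (L2dot u u + 1)) &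
    c <= L2dot h p.
Proof.
case: VS => V0 VD Vcl Vp.
have [e0 e0_gt0 He0] : exists2 e, 0 < e &
    forall w, V w -> e <= L2dot (p - w) (p - w).
  apply: contrapT => H; apply: Vp; apply: Vcl => e e_gt0.
  apply: contrapT => H'; apply: H; exists e => // w Vw.
  by rewrite leNgt; apply/negP => ?; apply: H'; exists w.
pose S := [set L2dot (p - w) (p - w) | w in V].
have Slb : lbound S e0 by move=> _ [w Vw <-]; exact: He0.
have Sinf : has_inf S.
  by split; [exists (L2dot (p - 0) (p - 0)), 0|exists e0].
set D := inf S.
have D_gt0 : 0 < D by apply: (lt_le_trans e0_gt0); apply: lb_le_inf => //; case: Sinf.
have SD w : V w -> D <= L2dot (p - w) (p - w).
  by move=> Vw; apply: ge_inf; [case: Sinf|exists w].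
exists (D / 2) => [|e e_gt0]; first by rewrite divr_gt0.
(* [K] will bound [L2dot w w + 1]. Of the bounds on [t], [t <= e] serves the near orthogonality and
   [t * K <= D / 2] the lower bound on [L2dot h p]. *)
pose K := 2 * L2dot p p + 2 * (D + 1) + 1.
have qp := L2dotxx_ge0 p.
have K_gt0 : 0 < K by rewrite /K; lra.
pose t := Num.min 1 (Num.min e (D / (2 * K))).
have t_gt0 : 0 < t by rewrite !lt_min ltr01 e_gt0 divr_gt0// mulr_gt0.
have t1 : t <= 1 by rewrite ge_min lexx.
have te : t <= e by rewrite !ge_min lexx !orbT.
have tD : t * K <= D / 2.
  have : t <= D / (2 * K) by rewrite !ge_min lexx !orbT.
  by rewrite ler_pdivlMr ?mulr_gt0// => ?; lra.
have [_ [w Vw <-]] := inf_adherent (exprn_gt0 2 t_gt0) Sinf.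
rewrite -/D; set h := p - w => hD.
(* Compare [w] with the competitor [t u + w]: expanding [D <= |h - t u|^2] and using
   [|h|^2 < D + t^2] bounds the cross term. *)
have hu u : V u -> L2dot h u <= t * (L2dot u u + 1).
  move=> Vu; have := SD _ (VD t%:C _ _ Vu Vw).
  rewrite opprD addrA addrAC -/h L2dotBB => H.
  have : 2 * t * L2dot h u < t * (t * (L2dot u u + 1)) by rewrite expr2 in hD H; lra.
  rewrite -mulrA mulrCA ltr_pM2l//.
  have := L2dotxx_ge0 u => q0 ?.
  have : 0 <= t * (L2dot u u + 1) by rewrite mulr_ge0 ?(ltW t_gt0)// addr_ge0.
  lra.
exists h => [u Vu|].
  by rewrite (le_trans (hu u Vu))// ler_wpM2r// addr_ge0// L2dotxx_ge0.
have wE : w = p - h by rewrite /h opprB addrC subrK.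
have qh := SD _ Vw; rewrite -/h in qh.
have t2 : t ^+ 2 <= 1 by rewrite expr_le1// ltW.
have qw : L2dot w w + 1 <= K.
  (* Parallelogram law for [w = p - h], with [|h|^2 < D + 1]. *)
  have := L2dotBB 1 p h; have := L2dotBB (-1) p h.
  rewrite !rmorphN rmorph1 scaleN1r scale1r -wE opprK => Hp Hm.
  have := L2dotxx_ge0 (p + h); rewrite /K; lra.
(* Testing with [- w] gives [L2dot h w >= - D / 2], while [L2dot h h >= D]; their sum is
   [L2dot h p]. *)
have := hu _ (L2subspaceZ (-1) Vw); rewrite scaleN1r !L2dotNr L2dotNl opprK => H.
have {}H : - L2dot h w <= D / 2.
  by apply: (le_trans H); apply: le_trans tD; rewrite ler_pM2l.
have -> : p = h + w by rewrite /h subrK.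
by rewrite L2dotDr; lra.
Qed.

(** The error of the n-th approximation is the restriction of [f] to [B] minus [B_ n], and these
    sets eventually leave every point. *)
Lemma L2subspace_restr_cvg (B : set X) (mB : measurable B) (B_ : nat -> set X)
    (mB_ : forall n, measurable (B_ n)) f :
  (forall n, B_ n `<=` B) -> (forall x, B x -> \forall n \near \oo, B_ n x) ->
  (forall n, V (L2restr (mB_ n) f)) -> V (L2restr mB f).
Proof.
move=> B_B BB_ VB; case: VS => _ _ Vcl; apply: Vcl => e e0.
have mD n : measurable (B `\` B_ n) by exact: measurableD.
have [x|n qn] := @L2dot_restr_small _ _ _ _ _ mD f e _ e0.
  have [Bx|nBx] := pselect (B x); last by apply: nearW => n [].
  by apply: filterS (BB_ _ Bx) => n Bnx [].
exists (L2restr (mB_ n) f) => //.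
suff -> : L2restr mB f - L2restr (mB_ n) f = L2restr (mD n) f by [].
apply/val_inj/funext => x /=; rewrite !fctE /= /restr_fun.
rewrite in_setD; have [Bnx|] := boolP (x \in B_ n).
  by rewrite (mem_set (B_B _ _ (set_mem Bnx))) subrr.
by rewrite subr0 andbT.
Qed.

End theory.
End closed_subspace.

(** * Weak approximation of a restriction by the Koopman operators *)

Section weak_limit.
Context d (X : measurableType d) (R : realType).
Variables (mu : probability X R) (G : groupType) (a : qi_action mu G).
Implicit Types (f h : L2fun mu) (A : set X).

(** Every measurable subset of [D] is its own image under [g], so [translate g] and [mu] agree
    inside [D]. *)
Lemma RN_fixed g D : measurable D -> (forall x, D x -> a g x = x) ->
  {ae mu, forall x, D x -> RN a g x = 1}.
Proof.
move=> mD Dg.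
have : ae_eq mu D (EFin \o RN a g) (EFin \o cst 1).
  apply: integral_ae_eq => //.
  - exact: integrableS (RN_integrable a g).
  - by apply/measurable_EFinP; exact: measurable_cst.
  - move=> B BD mB; rewrite [LHS](RN_int a g mB) [RHS](integral_cst mu mB 1) mul1e /translate.
    congr (mu _); apply/seteqP; split=> [_ [x Bx <-]|x Bx].
      by rewrite Dg//; exact: BD.
    by exists x; rewrite ?Dg//; exact: BD.
by apply: filterS => x /= H /H [].
Qed.

(** Integrates in one step a pointwise bound by a weighted sum of squares; the pairs in [s] are
    weights and functions. *)
Lemma le_L2dot_sum (s : seq (R * L2fun mu)) f h :
  {ae mu, forall x, dot (f x) (h x) <=
    \sum_(i <- s) i.1 * dot (i.2 x) (i.2 x)} ->
  L2dot f h <= \sum_(i <- s) i.1 * L2dot i.2 i.2.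
Proof.
move=> fh.
have [Is ->] : mu.-integrable setT
      (fun x => (\sum_(i <- s) i.1 * dot (i.2 x) (i.2 x))%:E) /\
    \sum_(i <- s) i.1 * L2dot i.2 i.2 =
      \int[mu]_x \sum_(i <- s) i.1 * dot (i.2 x) (i.2 x).
  elim: s {fh} => [|i s [IH1 IH2]].
    split.
      rewrite (_ : (fun x => _) = cst 0%E); first exact: integrable0.
      by apply/funext => x; rewrite big_nil.
    rewrite big_nil (@eq_Rintegral _ _ _ _ _ (cst 0)) ?Rintegral_cst// ?mul0r//.
    by move=> x _; rewrite big_nil.
  have Ii : mu.-integrable setT (fun x => (i.1 * dot (i.2 x) (i.2 x))%:E).
    exact: (integrableZl measurableT i.1 (integrable_dot i.2 i.2)).
  split.
    rewrite (_ : (fun x => _) = (fun x => (i.1 * dot (i.2 x) (i.2 x))%:E +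
        (\sum_(i <- s) i.1 * dot (i.2 x) (i.2 x))%:E)%E).
      exact: integrableD.
    by apply/funext => x; rewrite big_cons.
  rewrite big_cons IH2 /L2dot -RintegralZl//; last exact: integrable_dot.
  rewrite -RintegralD//.
  by apply: eq_Rintegral => x _; rewrite big_cons.
by apply: ae_le_Rintegral => //; exact: integrable_dot.
Qed.

Lemma L2dot_koopman g f :
  L2dot (koopman_L2fun a g f) (koopman_L2fun a g f) = L2dot f f.
Proof.
have : L2norm _ = L2norm _ := koopman_map_isometry a g (\pi_(L2 mu)%qT f).
rewrite koopman_map_pi !L2norm_dot => /complexI.
by move=> /eqP; rewrite eqr_sqrt ?L2dotxx_ge0// => /eqP.
Qed.

Lemma cst1_sq_integrable : (cst 1 : X -> R[i]) \in sq_integrable mu.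
Proof.
apply/sq_integrableP; split; first by split; exact: measurable_cst.
rewrite /finite_norm unlock /=.
rewrite (eq_integral (cst 1%E)) => [|x _]; last first.
  by rewrite expr1n expr0n addr0 sqrtr1 normr1 powR1.
by rewrite integral_cst// mul1e [X in (X `^ _)%E]probability_setT poweR1r ltry.
Qed.

Definition L2one : L2fun mu := MkL2fun cst1_sq_integrable.

Lemma L2oneE x : L2one x = 1.
Proof. by []. Qed.

Lemma L2dot_restr_one A (mA : measurable A) :
  L2dot (L2restr mA L2one) (L2restr mA L2one) = fine (mu A).
Proof.
rewrite -[in RHS](setIT A) -[in RHS]integral_indic// /L2dot /Rintegral; congr fine.
apply: eq_integral => x _; rewrite L2restrE dotxx indicE.
by case: ifP => _; rewrite ?L2oneE ?cmod1 ?cmod0 ?expr1n ?expr0n.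
Qed.

(** The union of a nearly optimal countable cover; it gives a measurable substitute for the possibly
    nonmeasurable support. *)
Lemma mu_ext_lt_cover A e : (mu_ext mu A < e)%E ->
  exists S, [/\ measurable S, A `<=` S & (mu S < e)%E].
Proof.
move=> /ereal_inf_lt[_ [F [mF AF] <-] Fe]; exists (\bigcup_k F k); split => //.
  exact: bigcupT_measurable.
apply: le_lt_trans Fe; apply: measure_sigma_subadditive => //.
exact: bigcupT_measurable.
Qed.

Lemma measurable_cmod_gt f (C : R) : measurable [set x | C < cmod (f x)].
Proof.
have mf := measurable_cmod (cmeasurable_L2fun f).
have -> : [set x | C < cmod (f x)] = (cmod \o f) @^-1` `]C, +oo[.
  by apply/seteqP; split => x /=; rewrite in_itv/= andbT.
by rewrite -[X in measurable X]setTI; exact: mf.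
Qed.

Lemma L2dot_truncation f e : 0 < e -> exists2 C : R, 0 < C &
  let mC := measurable_cmod_gt f C in L2dot (L2restr mC f) (L2restr mC f) < e.
Proof.
move=> e0.
have [x|n] := @L2dot_restr_small _ _ _ _ _
  (fun n => measurable_cmod_gt f n.+1%:R) f e _ e0; last by exists n.+1%:R.
have [k kf] : exists k, cmod (f x) <= k.+1%:R.
  exists (Num.truncn (cmod (f x))).
  by have /andP[_ /ltW] := truncn_itv (cmod_ge0 (f x)).
by exists k => // n /= kn; apply/negP; rewrite -leNgt (le_trans kf)// ler_nat ltnS.
Qed.

(* One term per region: off A and off the bad set the two functions agree; on A
   the factor s is at most M^-1, unless |f \o g| exceeds C; the bad set N is
   small. *)
Lemma koopman_contraction f h A (mA : measurable A) e :
  measure_contracting a -> 0 < e -> exists g,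
  L2dot h (L2restr (measurableC mA) f - koopman_L2fun a g f) <= e.
Proof.
move=> contr e0.
(* The constants split [e]: the terms of weight [t] total at most [e / 4], the tails of [f] and [h]
   beyond [C] and [K] at most [e / 8] each, and [M] and [b] are chosen to leave [e / 4] each. *)
pose T := 2 * L2dot f f + L2dot h h + 1.
have qf := L2dotxx_ge0 f; have qh := L2dotxx_ge0 h.
have T0 : 0 < T by rewrite /T; lra.
pose t := e / (4 * T).
have t0 : 0 < t by rewrite divr_gt0// mulr_gt0.
have tT : t * T = e / 4 by rewrite /t; field; rewrite gt_eqF.
have te0 : 0 < t * e / 8 by rewrite divr_gt0// mulr_gt0.
have [C C0 /= qC] := L2dot_truncation f te0.
have [K K0 /= qK] := L2dot_truncation h te0.
set fC := L2restr _ f in qC; set hK := L2restr _ h in qK.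
pose M := 4 * C * (1 + L2dot h h) / e.
have h10 : 0 < 1 + L2dot h h by lra.
have M0 : 0 < M by rewrite divr_gt0// !mulr_gt0.
pose b := t * e / (8 * K ^+ 2).
have K20 : 0 < K ^+ 2 by rewrite exprn_gt0.
have b0 : 0 < b by apply: divr_gt0; apply: mulr_gt0.
have [g0 []] := contr A mA M b M0 b0.
move=> /mu_ext_lt_cover[S [mS gS muS]].
set A' := [set x | _] => muA'.
have mA' : measurable A'.
  have ms : measurable_fun setT (fun x => Num.sqrt (RN a g0 x)).
    by apply: (measurableT_comp (@measurable_sqrt R)); exact: measurable_RN.
  have -> : A' = A `&` (fun x => Num.sqrt (RN a g0 x)) @^-1` `]-oo, M^-1[.
    by apply/seteqP; split => x /=; rewrite in_itv.
  by apply: measurableI => //; rewrite -[X in measurable X]setTI; exact: ms.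
(* The bad set: a cover of the points moved outside [A], and the points of [A] where the derivative
   is not small. *)
pose N := S `|` (A `\` A').
have mN : measurable N by apply: measurableU => //; exact: measurableD.
have muN : fine (mu N) <= 2 * b.
  have muAA' : (mu (A `\` A') <= b%:E)%E.
    have -> : (mu (A `\` A') = mu A - mu A')%E.
      rewrite measureD//; last by rewrite ltey_eq fin_num_measure.
      by rewrite setIidr// => x [].
    move: muA'; rewrite -(fineK (fin_num_measure mu _ mA)).
    rewrite -(fineK (fin_num_measure mu _ mA')).
    rewrite -!EFinB !lte_fin lee_fin; lra.
  have : (mu N <= b%:E + b%:E)%E.
    apply: le_trans; first by apply: measureU2 => //; exact: measurableD.
    by apply: leeD => //; exact: ltW.
  by rewrite -(fineK (fin_num_measure mu _ mN)) -EFinD lee_fin; lra.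
have mD : measurable (~` A `&` ~` S) by apply: measurableI; exact: measurableC.
have Dfix x : (~` A `&` ~` S) x -> a g0 x = x.
  by move=> [nAx nSx]; apply: contrapT => gx; apply: nSx; exact: gS.
(* The inverse, since [koopman_fun g] carries the derivative of [g^-1], which must be the
   contracting [g0]. *)
pose g := g0^-1%g; exists g.
pose k := koopman_L2fun a g f; pose kC := koopman_L2fun a g fC.
have kE x : k x = (Num.sqrt (RN a g0 x))%:C * f (a g0 x).
  by rewrite /k /= /koopman_fun /g invgK.
have kCE x : C < cmod (f (a g0 x)) -> kC x = k x.
  rewrite kE /kC /= /koopman_fun /g invgK => Cf.
  by rewrite /fC /= /restr_fun mem_set.
have hKE x : K < cmod (h x) -> hK x = h x.
  by move=> Kh; rewrite /hK /= /restr_fun mem_set.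
have qk : L2dot k k = L2dot f f by exact: L2dot_koopman.
have qkC : L2dot kC kC = L2dot fC fC by exact: L2dot_koopman.
have [u uE qu] : exists2 u : L2fun mu, forall x, u x = 1 & L2dot u u = 1.
  exists L2one => //; rewrite /L2dot (@eq_Rintegral _ _ _ _ _ (cst 1)).
    rewrite Rintegral_cst// mul1r -[RHS]/(fine 1%:E); congr fine.
    exact: probability_setT.
  by move=> x _; rewrite L2oneE dotxx cmod1 expr1n.
have [uN uNE quN] : exists2 uN : L2fun mu, forall x, N x -> uN x = 1 &
    L2dot uN uN = fine (mu N).
  exists (L2restr mN L2one); last exact: L2dot_restr_one.
  by move=> x Nx; rewrite L2restrE mem_set.
set v := _ - _.
have vE x : v x = (if x \in ~` A then f x else 0) - k x by [].
clearbody k kC fC hK v.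
(* Weights [t] and [t^-1] come from Young's inequality [2yz <= t y^2 + t^-1 z^2]; the last two
   entries bound [|h| * (C / M)] through [|h| <= 1 + |h|^2]. *)
pose s : seq (R * L2fun mu) := [:: (t, k); (t, f); (t, h); (t^-1, hK);
  (t^-1 * K ^+ 2, uN); (t^-1, kC); (C / M, u); (C / M, h)].
apply: (@le_trans _ _ (\sum_(i <- s) i.1 * L2dot i.2 i.2)); last first.
  rewrite /s !big_cons big_nil /= qk qkC qu quN.
  have CM : C / M * (1 + L2dot h h) = e / 4.
    by rewrite /M; field; rewrite !gt_eqF.
  have tq q : q < t * e / 8 -> t^-1 * q <= e / 8.
    move=> /ltW qe; rewrite mulrC ler_pdivrMr//; lra.
  have := tq _ qC; have := tq _ qK.
  have : t^-1 * K ^+ 2 * fine (mu N) <= e / 4.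
    rewrite -mulrA mulrC ler_pdivrMr//.
    have : K ^+ 2 * fine (mu N) <= K ^+ 2 * (2 * b) by rewrite ler_pM2l.
    have -> : K ^+ 2 * (2 * b) = e / 4 * t by rewrite /b; field; rewrite gt_eqF.
    by [].
  move: tT CM; rewrite /T; lra.
apply: le_L2dot_sum.
apply: filterS (RN_fixed mD Dfix) => x RNx.
rewrite /s !big_cons big_nil /= !dotxx uE cmod1.
set F := cmod (f x); set H := cmod (h x); set Q := cmod (k x).
have F0 : 0 <= F := cmod_ge0 _.
have H0 : 0 <= H := cmod_ge0 _.
have Q0 : 0 <= Q := cmod_ge0 _.
have ti : t * t^-1 = 1 by rewrite divff// gt_eqF.
have ti0 : 0 < t^-1 by rewrite invr_gt0.
have young y z : 2 * (y * z) <= t * y ^+ 2 + t^-1 * z ^+ 2.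
  have : 0 <= t * (y - t^-1 * z) ^+ 2 by rewrite mulr_ge0 ?sqr_ge0// ltW.
  have -> : t * (y - t^-1 * z) ^+ 2 =
    t * y ^+ 2 - 2 * (t * t^-1) * (y * z) + (t * t^-1) * t^-1 * z ^+ 2 by ring.
  rewrite ti; lra.
have hv : dot (h x) (v x) <= H * cmod (v x) := le_dot _ _.
have CM0 : 0 <= C / M by rewrite divr_ge0// ltW.
have tp y : 0 <= t * y ^+ 2 by rewrite mulr_ge0 ?sqr_ge0// ltW.
have tip y : 0 <= t^-1 * y ^+ 2 by rewrite mulr_ge0 ?sqr_ge0// ltW.
have tiK y : 0 <= t^-1 * K ^+ 2 * y ^+ 2.
  by rewrite mulr_ge0 ?sqr_ge0// mulr_ge0 ?ltW.
have CMp y : 0 <= C / M * y ^+ 2 by rewrite mulr_ge0 ?sqr_ge0.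
have cmodN (z : R[i]) : cmod (- z) = cmod z.
  by rewrite -mulN1r cmodM -(rmorphN1 (real_complex R)) cmod_real normrN1 mul1r.
rewrite expr1n addr0.
have := (tp F, tp H, tp Q, tip (cmod (hK x)), tip (cmod (kC x)),
  tiK (cmod (uN x)), CMp H).
move=> [[[[[[tF tH] tQ] thK] tkC] tuN] CMH].
have [Nx|nNx] := pselect (N x).
  rewrite uNE// cmod1 expr1n.
  have vx : cmod (v x) <= F + Q.
    rewrite vE; apply: le_trans (le_cmodD _ _) _; rewrite cmodN lerD2r.
    by case: ifP => // _; rewrite cmod0.
  have HFQ : H * cmod (v x) <= F * H + Q * H.
    by rewrite -mulrDl mulrC ler_wpM2r.
  (* Where [|h|] exceeds [K] it is absorbed by its tail [hK]; elsewhere [K] bounds it, at a cost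
     proportional to the measure of [N]. *)
  have hKH : t^-1 * H ^+ 2 <= t^-1 * cmod (hK x) ^+ 2 + t^-1 * K ^+ 2.
    rewrite -mulrDr ler_pM2l//; have [KH|HK] := ltP K H.
      by rewrite hKE// lerDl ltW.
    have : H ^+ 2 <= K ^+ 2 by rewrite ler_sqr ?nnegrE// ltW.
    by move=> /le_trans; apply; rewrite lerDr sqr_ge0.
  have := young F H; have := young Q H; lra.
have [Ax|nAx] := pselect (A x); last first.
  have -> : v x = 0.
    rewrite vE mem_set// kE RNx; last by split => // Sx; apply: nNx; left.
    rewrite Dfix; last by split => // Sx; apply: nNx; left.
    by rewrite sqrtr1 mul1r subrr.
  rewrite /dot /= !mulr0 addr0; lra.
have A'x : A' x by apply: contrapT => nA'x; apply: nNx; right.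
have vQ : cmod (v x) = Q.
  by rewrite vE memNset ?sub0r ?cmodN// => /(_ Ax).
rewrite vQ in hv.
(* For large [|f|] at the image point, [k] coincides with the transported tail [kC]; otherwise the
   small derivative gives [|k| <= C / M]. *)
have [Cf|fC'] := ltP C (cmod (f (a g0 x))).
  rewrite kCE// -/Q; have := young H Q; have := tip Q; lra.
have QCM : Q <= C / M.
  rewrite /Q kE cmodM cmod_real ger0_norm ?sqrtr_ge0// mulrC.
  apply: ler_pM => //; rewrite ?cmod_ge0 ?sqrtr_ge0// ltW//.
  by case: A'x.
have : H * Q <= (1 + H ^+ 2) * (C / M).
  apply: ler_pM => //.
  have := sqr_ge0 (H - 1); have := sqr_ge0 H; rewrite !expr2; lra.
lra.
Qed.
End weak_limit.

(** * Sets all of whose functions lie in the subspace *)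

Section carries.
Context d (X : measurableType d) (R : realType).
Variable mu : {measure set X -> \bar R}.
Implicit Types f h u : L2fun mu.

Lemma L2restrDC A (mA : measurable A) f :
  L2restr mA f + L2restr (measurableC mA) f = f.
Proof.
apply/val_inj/funext => x; rewrite /= !fctE /= /restr_fun in_setC.
by case: (x \in A); rewrite ?addr0 ?add0r.
Qed.

Lemma L2restr_id A (mA : measurable A) f : (forall x, ~ A x -> f x = 0) ->
  L2restr mA f = f.
Proof.
move=> f0; apply/val_inj/funext => x; rewrite /= /restr_fun.
by case: ifPn => // /negP Ax; rewrite f0// => /mem_set.
Qed.

Definition L2carries (V : set (L2fun mu)) (B : set X) :=
  measurable B /\ forall f, (forall x, ~ B x -> f x = 0) -> V f.

Variable V : set (L2fun mu).
Hypothesis VS : L2subspace V.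

Lemma L2carries_set0 : L2carries V set0.
Proof.
split => // f f0; case: VS => V0 _ _.
suff -> : f = 0 by [].
by apply/val_inj/funext => x; exact: f0.
Qed.

Lemma L2carriesU A B : L2carries V A -> L2carries V B -> L2carries V (A `|` B).
Proof.
move=> [mA VA] [mB VB]; split => [|f f0]; first exact: measurableU.
rewrite -(L2restrDC mA f); apply: (L2subspaceD VS).
  by apply: VA => x nAx; rewrite L2restrE memNset.
apply: VB => x nBx; rewrite L2restrE in_setC.
by case: ifPn => // /negP Ax; apply: f0 => -[/mem_set|].
Qed.

(** Finite unions follow from [L2carriesU]; [f] is the limit of its restrictions to them. *)
Lemma L2carries_bigcup (F : nat -> set X) :
  (forall n, L2carries V (F n)) -> L2carries V (\bigcup_n F n).
Proof.
move=> VF.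
have VFn n : L2carries V (\big[setU/set0]_(i < n) F i).
  elim: n => [|n IHn]; first by rewrite big_ord0; exact: L2carries_set0.
  by rewrite big_ord_recr /=; exact: L2carriesU.
have mF : measurable (\bigcup_n F n).
  by apply: bigcupT_measurable => n; case: (VF n).
split => // f f0; rewrite -(L2restr_id mF f0).
apply: (@L2subspace_restr_cvg _ _ _ _ _ VS _ _ _ (fun n => proj1 (VFn n))).
- by move=> n x; rewrite -bigcup_mkord => -[i _ Fix]; exists i.
- move=> x [i _ Fix]; exists i.+1 => // n /= ni.
  by rewrite -bigcup_mkord; exists i.
- by move=> n; apply: (proj2 (VFn n)) => x nFx; rewrite L2restrE memNset.
Qed.

End carries.

(** * Invariant closed subspaces of a measure contracting action *)

Section invariant_subspace.
Context d (X : measurableType d) (R : realType).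
Variables (mu : probability X R) (G : groupType) (a : qi_action mu G).
Variable V : set (L2fun mu).
Hypothesis VS : L2subspace V.
Hypothesis Vinv : forall g f, V f -> V (koopman_L2fun a g f).
Hypothesis contr : measure_contracting a.
Implicit Types f h u : L2fun mu.

(** Otherwise some [h] nearly orthogonal to [V] pairs to at least [c] with the restriction of [f]
    off [A]. That pairing is nearly at most the one with an image of [f] in [V]: both errors are at
    most [c / 4], a contradiction. *)
Lemma invariant_restr A (mA : measurable A) f : V f -> V (L2restr mA f).
Proof.
move=> Vf.
suff VC : V (L2restr (measurableC mA) f).
  have -> : L2restr mA f = f - L2restr (measurableC mA) f.
    by rewrite -{2}(L2restrDC mA f) addrK.
  exact: (L2subspaceB VS).
apply: contrapT => /(L2subspace_separation VS)[c c0 Hc].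
have qf := L2dotxx_ge0 f.
have q0 : 0 < L2dot f f + 1 by lra.
have [|h hV hp] := Hc (c / (4 * (L2dot f f + 1))).
  by rewrite divr_gt0// mulr_gt0.
have [|g Hg] := koopman_contraction f h mA contr (e := c / 4).
  by rewrite divr_gt0.
have := hV _ (Vinv g Vf); rewrite L2dot_koopman.
have -> : c / (4 * (L2dot f f + 1)) * (L2dot f f + 1) = c / 4.
  by field; rewrite gt_eqF.
move: Hg; rewrite L2dotDr L2dotNr; lra.
Qed.

(** Changing the sign of [f] where the pairing is negative stays in [V] and keeps the norm, and
    turns the pairing into an L^1 norm. *)
Lemma invariant_L1_bound f h e : V f ->
  (forall u, V u -> L2dot h u <= e * (L2dot u u + 1)) ->
  \int[mu]_x `|dot (h x) (f x)| <= e * (L2dot f f + 1).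
Proof.
move=> Vf hV.
have mA : measurable [set x | 0 <= dot (h x) (f x)].
  have -> : [set x | 0 <= dot (h x) (f x)] =
      (fun x => dot (h x) (f x)) @^-1` `[0, +oo[.
    by apply/seteqP; split => x /=; rewrite in_itv/= andbT.
  rewrite -[X in measurable X]setTI.
  by apply: measurable_dot => //; exact: cmeasurable_L2fun.
pose u := L2restr mA f - L2restr (measurableC mA) f.
have uE x : u x = if 0 <= dot (h x) (f x) then f x else - f x.
  rewrite /u /= !fctE /= /restr_fun in_setC -[_ <= _]asboolb.
  rewrite -[asbool _]/(x \in [set x | 0 <= dot (h x) (f x)]).
  by case: (x \in _); rewrite ?subr0 ?sub0r.
have -> : L2dot f f = L2dot u u.
  apply: eq_Rintegral => x _; rewrite uE; case: ifP => // _.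
  by rewrite /dot !raddfN /= !mulrNN.
have -> : \int[mu]_x `|dot (h x) (f x)| = L2dot h u.
  apply: eq_Rintegral => x _; rewrite uE; case: ifPn => [|H].
    exact: ger0_norm.
  by rewrite ltr0_norm ?ltNge// /dot !raddfN /= !mulrN opprD.
apply: hV; apply: (L2subspaceB VS); exact: invariant_restr.
Qed.

Lemma invariant_carries f : V f -> L2carries V [set x | 0 < cmod (f x)].
Proof.
move=> Vf; split => [|p p0]; first exact: measurable_cmod_gt.
have mB := measurable_cmod_gt f 0.
rewrite -(L2restr_id mB p0).
(* On [B n] one has [|p| <= n (n + 1) |f|], so a small integral of [|f h|] makes that of [|p h|]
   small. *)
pose B n := [set x | n.+1%:R^-1 < cmod (f x)] `&` ~` [set x | n%:R < cmod (p x)].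
have mBn n : measurable (B n).
  by apply: measurableI; [|apply: measurableC]; exact: measurable_cmod_gt.
apply: (@L2subspace_restr_cvg _ _ _ _ _ VS _ _ _ mBn).
- by move=> n x [/= + _]; apply: lt_trans; rewrite invr_gt0.
- move=> x /= fx; near=> n; split => /=.
    by near: n; exact: near_infty_natSinv_lt (PosNum fx).
  apply/negP; rewrite -leNgt; near: n; exact: nbhs_infty_ger.
move=> n; apply: contrapT => /(L2subspace_separation VS)[c c0 Hc].
have qf := L2dotxx_ge0 f.
pose K : R := n%:R * n.+1%:R.
have K0 : 0 <= K by rewrite mulr_ge0.
(* [dot] sees only real parts; by [cmodM_le_dot], the L^1 bounds for [f] and ['i *: f] together
   control [|f h|]. *)
have Vif : V ('i *: f) by exact: (L2subspaceZ VS).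
have qif : L2dot ('i *: f) ('i *: f) = L2dot f f.
  apply: eq_Rintegral => x _; rewrite !dotxx -[('i *: f) x]/('i * f x) cmodM.
  by rewrite cmodE /= expr0n expr1n add0r sqrtr1 mul1r.
(* [K + 1] keeps the denominator positive when [n = 0]; each of the two L^1 norms, times [K], is
   then at most [c / 4]. *)
have D0 : 0 < 4 * (K + 1) * (L2dot f f + 1) by rewrite !mulr_gt0//; lra.
have [|h hV] := Hc (c / (4 * (K + 1) * (L2dot f f + 1))).
  by rewrite divr_gt0.
have := invariant_L1_bound Vf hV; have := invariant_L1_bound Vif hV.
rewrite qif.
set I1 := Rintegral _ _ _; set I2 := Rintegral _ _ _; set e := _ * (_ + 1).
have eE : K * e <= c / 4.
  have -> : e = c / (4 * (K + 1)).
    by rewrite /e; field; rewrite !gt_eqF//; lra.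
  rewrite mulrA ler_pdivrMr; last by lra.
  have : 0 <= c * K by rewrite mulr_ge0// ltW.
  lra.
move=> I1e I2e; apply/negP; rewrite -ltNge.
suff : L2dot h (L2restr (mBn n) p) <= K * (I2 + I1).
  have : K * I1 <= K * e by rewrite ler_wpM2l.
  have : K * I2 <= K * e by rewrite ler_wpM2l.
  lra.
have iN (u : L2fun mu) : mu.-integrable setT (fun x => `|dot (h x) (u x)|%:E).
  exact: (integrable_norm (integrable_dot h u)).
rewrite /I1 /I2 -RintegralD//; [|exact: iN..].
have iS : mu.-integrable setT
    (EFin \o (fun x => `|dot (h x) (f x)| + `|dot (h x) (('i *: f) x)|)).
  exact: (integrableD measurableT (iN f) (iN ('i *: f))).
rewrite -RintegralZl//; apply: le_Rintegral => //; first exact: integrable_dot.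
  exact: (integrableZl measurableT K iS).
move=> x _; apply: (le_trans (le_dot _ _)); rewrite L2restrE.
case: ifPn => [/set_mem[/= fx /negP]|_]; last first.
  by rewrite cmod0 mulr0 mulr_ge0// addr_ge0.
rewrite -leNgt => px; rewrite !(dotC (h x)).
apply: (@le_trans _ _ (K * (cmod (f x) * cmod (h x)))); last first.
  by rewrite ler_wpM2l// cmodM_le_dot.
rewrite mulrA mulrC ler_wpM2r ?cmod_ge0// (le_trans px)//.
rewrite /K -mulrA ler_peMr// -ler_pdivrMl// mulr1 ltW//.
Unshelve. all: by end_near.
Qed.

(** The operator of [g^-1] moves [f] to a function vanishing off [B], hence in [V]; the operator of
    [g] brings it back up to a null set. *)
Lemma invariant_carries_image g B : L2carries V B -> L2carries V (a g @` B).
Proof.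
move=> [mB VB]; split => [|f f0]; first exact: measurable_qi_act_image.
apply: (L2subspace_ae VS (f := koopman_L2fun a g (koopman_L2fun a g^-1%g f))).
  apply/L2_eqP; rewrite -!koopman_map_pi -koopman_mapM mulgV.
  exact: koopman_map1.
apply: Vinv; apply: VB => x nBx.
rewrite /= /koopman_fun invgK f0 ?mulr0// => -[y By].
by move=> /(can_inj (qi_actK a g)) yx; apply: nBx; rewrite -yx.
Qed.

(** The union of a sequence whose measures approach the supremum attains it; adjoining [B] cannot
    exceed the supremum, so it adds measure 0. *)
Lemma L2carries_max : exists2 E, L2carries V E &
  forall B, L2carries V B -> mu (B `\` E) = 0%E.
Proof.
pose S := [set fine (mu B) | B in L2carries V].
have Sub : ubound S 1.
  move=> _ [B [mB _] <-]; rewrite -[leRHS]/(fine 1%:E) fine_le//.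
    exact: fin_num_measure.
  exact: probability_le1.
have Ssup : has_sup S.
  by split; [exists (fine (mu set0)), set0 => //; exact: L2carries_set0|exists 1].
have /choice[F FP] (n : nat) : exists B, L2carries V B /\
    sup S - n.+1%:R^-1 < fine (mu B).
  have [|_ [B VB <-] HB] := @sup_adherent _ S n.+1%:R^-1 _ Ssup.
    by rewrite invr_gt0.
  by exists B.
have VE : L2carries V (\bigcup_n F n).
  by apply: (L2carries_bigcup VS) => n; case: (FP n).
exists (\bigcup_n F n) => // B VB.
have mE := proj1 VE; have mB := proj1 VB.
set E := \bigcup_n F n in VE mE *.
have mD : measurable (B `\` E) by exact: measurableD.
have SE : sup S <= fine (mu E).
  apply/ler_addgt0Pr => e e0.
  have [n ne] : exists n, n.+1%:R^-1 < e.
    have [n _ /(_ n (leqnn n)) H] := near_infty_natSinv_lt (PosNum e0).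
    by exists n.
  have [[mF _] Fn] := FP n.
  have : fine (mu (F n)) <= fine (mu E).
    rewrite fine_le ?fin_num_measure// le_measure ?inE//.
    exact: bigcup_sup.
  move: ne Fn; set r := n.+1%:R^-1; lra.
have EB : fine (mu (E `|` B)) <= sup S.
  apply: ub_le_sup; first by case: Ssup.
  by exists (E `|` B) => //; exact: (L2carriesU VS).
have : mu (E `|` B) = (mu E + mu (B `\` E))%E.
  rewrite -measureU//; last by rewrite setDE setICA setICr setI0.
  by rewrite setDE setUIr setUv setIT.
rewrite -(fineK (fin_num_measure mu _ mE)) -(fineK (fin_num_measure mu _ mD)).
rewrite -(fineK (fin_num_measure mu _ (measurableU _ _ mE mB))) -EFinD => -[H].
have : 0 <= fine (mu (B `\` E)) by exact: fine_ge0.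
move=> H0; congr (_%:E); lra.
Qed.

Lemma invariant_trivial : ergodic a ->
  (forall f, V f -> {ae mu, forall x, f x = 0}) \/ (forall f, V f).
Proof.
move=> erg; have [E VE Emax] := L2carries_max.
have mE := proj1 VE.
have mgE g : measurable (a g @` E) by exact: measurable_qi_act_image.
have gE g : mu ((a g @` E) `\` E) = 0%E.
  by apply: Emax; exact: invariant_carries_image.
have [g|E0|E1] := erg E mE.
- apply: null_set_setU; [exact: measurableD|exact: measurableD|exact: gE|].
  (* The other half of the symmetric difference is the image under [g] of the same kind of set for
     [g^-1], null by quasi-invariance. *)
  have -> : E `\` (a g @` E) = a g @` ((a g^-1%g @` E) `\` E).
    rewrite !qi_act_image invgK; apply/seteqP; split => x /=.
      by move=> [Ex nEx]; rewrite qi_actVK.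
    by rewrite qi_actVK.
  by apply/(qi_act_quasi_invariant a g) => //; exact: measurableD.
(* The set where [f] is nonzero is itself carried, hence contained in the null set [E] up to a null
   set. *)
- left => f Vf; have VB := invariant_carries Vf.
  have mB := proj1 VB.
  have mBE := measurableD mB mE.
  exists (([set x | 0 < cmod (f x)] `\` E) `|` E); split.
  + exact: measurableU.
  + by rewrite null_set_setU//; exact: Emax.
  + move=> x /= fx; have [|nEx] := pselect (E x); [by right|left; split => //=].
    rewrite lt_neqAle cmod_ge0 andbT; apply/eqP => /esym.
    by move=> /cmod_eq0.
- right => f; apply: (L2subspace_ae VS (f := L2restr mE f)).
    have E0 : mu (~` E) = 0%E by rewrite probability_setC// E1 subee.
    exists (~` E); split => //; first exact: measurableC.
    by move=> x /= fx Ex; apply: fx; rewrite /restr_fun mem_set.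
  by apply: (proj2 VE) => x nEx; rewrite L2restrE memNset.
Qed.

End invariant_subspace.

(** * Passage between functions and classes, and irreducibility *)

Lemma closed_L2subspace d (X : measurableType d) (R : realType)
    (mu : {measure set X -> \bar R}) (W : set (L2 mu)) :
  submod_closed (mem W) -> closed W ->
  L2subspace [set f : L2fun mu | W (\pi_(L2 mu)%qT f)].
Proof.
move=> [W0 WD] clW; split => /=.
- by move: W0; rewrite L2_pi0 inE.
- move=> c f g Wf Wg; rewrite L2_piD -L2scale_pi.
  by move: (WD c (\pi_(L2 mu)%qT f) (\pi_(L2 mu)%qT g)); rewrite !inE; exact.
- move=> f Hf; apply: clW => B /nbhs_normP[e /= e0 eB].
  (* The radius of a ball lies in [R[i]]; its positivity forces the imaginary part to vanish. *)
  have [e1 eE] : exists2 e1 : R, 0 < e1 & e = e1%:C.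
    case: e e0 {eB} => x y; rewrite ltcE /= => /andP[/eqP -> x0].
    by exists x.
  move=> eE'.
  have [g Wg qfg] := Hf (e1 ^+ 2) (exprn_gt0 2 eE).
  exists (\pi_(L2 mu)%qT g); split => //; apply: eB => /=.
  have -> : \pi_(L2 mu)%qT f = \pi_(L2 mu)%qT (f - g) + \pi_(L2 mu)%qT g.
    by rewrite -L2_piD subrK.
  rewrite addrK eE' [X in X < _](L2norm_dot (f - g)) ltcR.
  by rewrite -[e1]gtr0_norm// -sqrtr_sqr ltr_sqrt// exprn_gt0.
Qed.

Theorem theorem4 (R : realType) (d : measure_display) (X : measurableType d)
    (mu : probability X R) (G : groupType) (a : qi_action mu G) :
  ergodic a -> measure_contracting a -> irreducible (koopman a).
Proof.
move=> erg contr W smW clW invW.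
have VS := closed_L2subspace smW clW.
have Vinv g f : W (\pi_(L2 mu)%qT f) -> W (\pi_(L2 mu)%qT (koopman_L2fun a g f)).
  by rewrite -koopman_map_pi; exact: invW.
have [V0|VT] := invariant_trivial VS Vinv contr erg; [left|right].
  apply/seteqP; split => [|_ ->]; last by case: smW => + _; rewrite inE.
  elim/quotW => f /V0 f0 /=; rewrite -L2_pi0; exact/L2_eqP.
by apply/seteqP; split => //; elim/quotW => f _; exact: VT.
Qed.
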